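(* Let $A$ be the algebra in the category $\mathcal{C}$ with basis $\{\delta_s\otimes u : s\in M,\ u\in G\}$ described in the context. Then the element $\rho=\sum_{u\in G}\delta_e\otimes u\in A$ is an integral element, i.e. it is both a right and a left integral: for every $h\in A$, $\rho h=\epsilon(h)\rho$ and $h\rho=\epsilon(h)\rho$.
   Context: $X$ is a finite group with identity $e$, $G\subset X$ a subgroup, and $M\subset X$ a set of coset representatives with $e\in M$: every $x\in X$ factors uniquely as $x=us$ with $u\in G$, $s\in M$. For $s,t\in M$ and $u\in G$ define $\tau(s,t)\in G$, $s\cdot t\in M$, $s\triangleright u\in G$, $s\triangleleft u\in M$ by unique factorization: $$st=\tau(s,t)(s\cdot t),\qquad su=(s\triangleright u)(s\triangleleft u).$$ It is assumed that $(M,\cdot)$ has left division: for all $s,p\in M$ there is a unique $t\in M$ with $s\cdot t=p$. All vector spaces are finite dimensional over a field $k$. $\mathcal{C}$ is the tensor category of $M$-graded right $G$-representations $V=\bigoplus_{s\in M}V_s$ with the action $\bar\triangleleft$ satisfying $\langle \xi\bar\triangleleft u\rangle=\langle\xi\rangle\triangleleft u$, where $\langle\xi\rangle$ denotes the grade of a homogeneous element $\xi$. $A$ is the $k$-vector space with basis $\delta_s\otimes u$ ($s\in M$, $u\in G$). The grade $\langle\delta_s\otimes u\rangle\in M$ is defined by $s\cdot\langle\delta_s\otimes u\rangle=s\triangleleft u$. The (in general not associative in the usual sense) product is $$(\delta_s\otimes u)(\delta_t\otimes v)=\delta_{t,\,s\triangleleft u}\ \delta_{s\triangleleft\tau(a,b)}\otimes\tau(a,b)^{-1}uv,\qquad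 a=\langle\delta_s\otimes u\rangle,\ b=\langle\delta_t\otimes v\rangle,$$ where $\delta_{t,s\triangleleft u}$ is the Kronecker delta, and the counit is $\epsilon(\delta_s\otimes u)=\delta_{s,e}$. *)

(* Defs.v *)
From HB Require Import structures.
From mathcomp Require Import all_boot all_order all_algebra all_fingroup.

Set Implicit Arguments.
Unset Strict Implicit.
Unset Printing Implicit Defensive.

Import GRing.Theory.
Local Open Scope ring_scope.

(* The group G and the set M as finite types; elements coerce back to X by    *)
(* val (sgval for G, which also carries the group structure of G).            *)
Notation Gtype G := (subg_of G%G).
Notation Mtype M := {s : _ | s \in M}.

Definition unique_factorization (X : finGroupType) (G : {group X})
    (M : {set X}) : Prop :=
  forall x : X, exists! us : Gtype G * Mtype M, x = (val us.1 * val us.2)%g.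

Lemma factor_ex (X : finGroupType) (G : {group X}) (M : {set X}) :
  unique_factorization G M ->
  forall x : X, exists us : Gtype G * Mtype M, x == (val us.1 * val us.2)%g.
Proof. by move=> fM x; have [us [/eqP us_x _]] := fM x; exists us. Qed.

Definition factor (X : finGroupType) (G : {group X}) (M : {set X})
    (fM : unique_factorization G M) (x : X) : Gtype G * Mtype M :=
  xchoose (factor_ex fM x).

(* s t = tau(s, t) (s . t) *)
Definition tau (X : finGroupType) (G : {group X}) (M : {set X})
    (fM : unique_factorization G M) (s t : Mtype M) : Gtype G :=
  (factor fM (val s * val t)%g).1.

Definition dot (X : finGroupType) (G : {group X}) (M : {set X})
    (fM : unique_factorization G M) (s t : Mtype M) : Mtype M :=
  (factor fM (val s * val t)%g).2.

(* s u = (s |> u) (s <| u) *)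
Definition lact (X : finGroupType) (G : {group X}) (M : {set X})
    (fM : unique_factorization G M) (s : Mtype M) (u : Gtype G) : Gtype G :=
  (factor fM (val s * val u)%g).1.

Definition ract (X : finGroupType) (G : {group X}) (M : {set X})
    (fM : unique_factorization G M) (s : Mtype M) (u : Gtype G) : Mtype M :=
  (factor fM (val s * val u)%g).2.

Definition left_division (X : finGroupType) (G : {group X}) (M : {set X})
    (fM : unique_factorization G M) : Prop :=
  forall s p : Mtype M, exists! t : Mtype M, dot fM s t = p.

Lemma ldiv_ex (X : finGroupType) (G : {group X}) (M : {set X})
    (fM : unique_factorization G M) :
  left_division fM ->
  forall s p : Mtype M, exists t : Mtype M, dot fM s t == p.
Proof. by move=> dM s p; have [t [/eqP t_p _]] := dM s p; exists t. Qed.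

Definition ldiv (X : finGroupType) (G : {group X}) (M : {set X})
    (fM : unique_factorization G M) (dM : left_division fM)
    (s p : Mtype M) : Mtype M :=
  xchoose (ldiv_ex dM s p).

Lemma factorE (X : finGroupType) (G : {group X}) (M : {set X})
    (fM : unique_factorization G M) (x : X) :
  x = (val (factor fM x).1 * val (factor fM x).2)%g.
Proof. exact/eqP/(xchooseP (factor_ex fM x)). Qed.

Lemma factor_uniq (X : finGroupType) (G : {group X}) (M : {set X})
    (fM : unique_factorization G M) (u : Gtype G) (s : Mtype M) :
  factor fM (val u * val s)%g = (u, s).
Proof.
have [us [_ us_uniq]] := fM (val u * val s)%g.
by rewrite -(us_uniq (u, s) erefl) -(us_uniq _ (factorE fM _)).
Qed.

Lemma dot_ldiv (X : finGroupType) (G : {group X}) (M : {set X})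
    (fM : unique_factorization G M) (dM : left_division fM)
    (s p : Mtype M) :
  dot fM s (ldiv dM s p) = p.
Proof. exact/eqP/(xchooseP (ldiv_ex dM s p)). Qed.

Definition Mone (X : finGroupType) (M : {set X}) (eM : 1%g \in M) : Mtype M :=
  exist _ 1%g eM.

(* The grade <delta_s (x) u>, determined by s . <delta_s (x) u> = s <| u.     *)
Definition grade (X : finGroupType) (G : {group X}) (M : {set X})
    (fM : unique_factorization G M) (dM : left_division fM)
    (su : Mtype M * Gtype G) : Mtype M :=
  ldiv dM su.1 (ract fM su.1 su.2).

(* The space A with basis delta_s (x) u; an element is given by its           *)
(* coordinates. Its product is Amul below, not the pointwise product.         *)
Notation Aspace k G M := {ffun Mtype M * Gtype G -> (k^o)%type}.

Definition Abasis (k : fieldType) (X : finGroupType) (G : {group X})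
    (M : {set X}) (s : Mtype M) (u : Gtype G) : Aspace k G M :=
  [ffun tv => (tv == (s, u))%:R].

(* (delta_s (x) u) (delta_t (x) v) for su = (s, u) and tv = (t, v).           *)
Definition Amul_basis (k : fieldType) (X : finGroupType) (G : {group X})
    (M : {set X}) (fM : unique_factorization G M) (dM : left_division fM)
    (su tv : Mtype M * Gtype G) : Aspace k G M :=
  let: (s, u) := su in
  let: (t, v) := tv in
  let c := tau fM (grade dM su) (grade dM tv) in
  (t == ract fM s u)%:R *: Abasis k (ract fM s c) (c^-1 * u * v)%g.

Definition Amul (k : fieldType) (X : finGroupType) (G : {group X})
    (M : {set X}) (fM : unique_factorization G M) (dM : left_division fM)
    (x y : Aspace k G M) : Aspace k G M :=
  \sum_(p : Mtype M * Gtype G) \sum_(q : Mtype M * Gtype G)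
    (x p * y q) *: Amul_basis k dM p q.

Definition counit (k : fieldType) (X : finGroupType) (G : {group X})
    (M : {set X}) (eM : 1%g \in M) (x : Aspace k G M) : k :=
  \sum_(p : Mtype M * Gtype G) x p * (p.1 == Mone eM)%:R.

Lemma Abasis_sum (k : fieldType) (X : finGroupType) (G : {group X})
    (M : {set X}) (x : Aspace k G M) :
  x = \sum_(p : Mtype M * Gtype G) x p *: Abasis k p.1 p.2.
Proof.
apply/ffunP=> q; rewrite sum_ffunE (bigD1 q) //= big1 => [|p p_q].
  by rewrite !ffunE -surjective_pairing eqxx addr0 /GRing.scale /= mulr1.
rewrite !ffunE -surjective_pairing eq_sym (negbTE p_q).
exact: mulr0.
Qed.

Lemma Amul_Abasis (k : fieldType) (X : finGroupType) (G : {group X})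
    (M : {set X}) (fM : unique_factorization G M) (dM : left_division fM)
    (s t : Mtype M) (u v : Gtype G) :
  Amul dM (Abasis k s u) (Abasis k t v) = Amul_basis k dM (s, u) (t, v).
Proof.
rewrite /Amul (bigD1 (s, u)) //= (bigD1 (t, v)) //= !ffunE !eqxx mulr1 scale1r.
rewrite !big1 ?addr0 // => [p /negbTE p_su|q /negbTE q_tv]; last first.
  by rewrite !ffunE q_tv mulr0 scale0r.
by apply: big1 => q _; rewrite !ffunE p_su mul0r scale0r.
Qed.

Lemma counit_Abasis (k : fieldType) (X : finGroupType) (G : {group X})
    (M : {set X}) (eM : 1%g \in M) (s : Mtype M) (u : Gtype G) :
  counit eM (Abasis k s u) = (s == Mone eM)%:R.
Proof.
rewrite /counit (bigD1 (s, u)) //= ffunE eqxx mul1r big1 ?addr0 //.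
by move=> p /negbTE p_su; rewrite ffunE p_su mul0r.
Qed.

Definition right_integral (k : fieldType) (X : finGroupType) (G : {group X})
    (M : {set X}) (eM : 1%g \in M) (fM : unique_factorization G M)
    (dM : left_division fM) (r : Aspace k G M) : Prop :=
  forall h : Aspace k G M, Amul dM r h = counit eM h *: r.

Definition left_integral (k : fieldType) (X : finGroupType) (G : {group X})
    (M : {set X}) (eM : 1%g \in M) (fM : unique_factorization G M)
    (dM : left_division fM) (r : Aspace k G M) : Prop :=
  forall h : Aspace k G M, Amul dM h r = counit eM h *: r.

Definition integral_element (k : fieldType) (X : finGroupType) (G : {group X})
    (M : {set X}) (eM : 1%g \in M) (fM : unique_factorization G M)
    (dM : left_division fM) (r : Aspace k G M) : Prop :=
  right_integral eM dM r /\ left_integral eM dM r.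

Definition rho (k : fieldType) (X : finGroupType) (G : {group X})
    (M : {set X}) (eM : 1%g \in M) : Aspace k G M :=
  \sum_(u : Gtype G) Abasis k (Mone eM) u.

(* Main.v *)
Require Import Defs.
From mathcomp Require Import all_boot all_order all_algebra all_fingroup.

(** Everything rests on the unit of [M] being both fixed and isolated under
    the right action: [e <| u = e] because [e u = u e], and conversely
    [s <| u = e] puts [s] in the intersection of [G] and [M], which unique
    factorization reduces to [e] (lemma [ract_eq1]). Hence each
    [delta_e (x) u] has grade [e], and since [tau(e, e) = 1] these basis
    elements multiply exactly like the elements of [G]: they span a copy of
    the group algebra of [G] inside [A] (lemma [Amul_basis11]). In this copy
    [rho] is the sum of all group elements, so it absorbs left and right
    translations. A basis element [delta_s (x) v] with [s <> e] multiplies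
    every [delta_e (x) u] to zero on either side, because the Kronecker delta
    in the product compares [s] or [s <| v] with [e]; and the counit kills it
    too. Bilinearity of the product extends both identities to [A]. *)

Set Implicit Arguments.
Unset Strict Implicit.
Unset Printing Implicit Defensive.

(* The action theory of finite groups has its own [ract]; the one of the
   factorization is meant throughout. *)
Import Defs.
Import GRing.Theory.
Local Open Scope ring_scope.

Lemma ract1 (X : finGroupType) (G : {group X}) (M : {set X}) (eM : 1%g \in M)
    (fM : unique_factorization G M) (u : Gtype G) :
  ract fM (Mone eM) u = Mone eM.
Proof.
have -> : ract fM (Mone eM) u = (factor fM (val u * val (Mone eM))%g).2.
  by rewrite /ract /= mul1g mulg1.
by rewrite factor_uniq.
Qed.

(** If [s <| u = e] then [s = (s |> u) u^-1] lies in [G]; both [s * e] and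
    [e * s] are then factorizations of [s]. *)
Lemma ract_eq1 (X : finGroupType) (G : {group X}) (M : {set X})
    (eM : 1%g \in M) (fM : unique_factorization G M) (s : Mtype M)
    (u : Gtype G) :
  (ract fM s u == Mone eM) = (s == Mone eM).
Proof.
apply/eqP/eqP=> [su_e | ->]; last exact: ract1.
have su_G : (val s * val u)%g = val (lact fM s u).
  rewrite [LHS](factorE fM) -/(lact fM s u) -/(ract fM s u) su_e.
  exact: mulg1.
have s_G : (val (1%g : Gtype G) * val s)%g
         = (val (lact fM s u * u^-1)%g * val (Mone eM))%g.
  by rewrite /= mul1g mulg1 -[sgval (lact fM s u)]su_G mulgK.
by have := factor_uniq fM 1%g s; rewrite s_G factor_uniq => -[].
Qed.

Lemma tau1 (X : finGroupType) (G : {group X}) (M : {set X}) (eM : 1%g \in M)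
    (fM : unique_factorization G M) (t : Mtype M) :
  tau fM (Mone eM) t = 1%g.
Proof. by have := factor_uniq fM 1%g t; rewrite /tau /= => ->. Qed.

Lemma dot1 (X : finGroupType) (G : {group X}) (M : {set X}) (eM : 1%g \in M)
    (fM : unique_factorization G M) (t : Mtype M) :
  dot fM (Mone eM) t = t.
Proof. by have := factor_uniq fM 1%g t; rewrite /dot /= => ->. Qed.

Lemma grade1 (X : finGroupType) (G : {group X}) (M : {set X})
    (eM : 1%g \in M) (fM : unique_factorization G M) (dM : left_division fM)
    (u : Gtype G) :
  grade dM (Mone eM, u) = Mone eM.
Proof. by rewrite /grade -[LHS](dot1 eM fM) dot_ldiv ract1. Qed.

Lemma Amul_basis11 (k : fieldType) (X : finGroupType) (G : {group X})
    (M : {set X}) (eM : 1%g \in M) (fM : unique_factorization G M)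
    (dM : left_division fM) (u v : Gtype G) :
  Amul_basis k dM (Mone eM, u) (Mone eM, v) = Abasis k (Mone eM) (u * v)%g.
Proof.
by rewrite /Amul_basis !grade1 tau1 !ract1 eqxx scale1r invg1 mul1g.
Qed.

(** The [rho]-weighted sum over the basis only sees the fibre above [e]; this
    turns products with [rho] into sums over [G]. *)
Lemma rho_sum (k : fieldType) (X : finGroupType) (G : {group X})
    (M : {set X}) (eM : 1%g \in M) (F : Mtype M * Gtype G -> Aspace k G M) :
  \sum_p rho k G eM p *: F p = \sum_u F (Mone eM, u).
Proof.
rewrite (eq_bigr (fun p => \sum_u (p == (Mone eM, u))%:R *: F p)).
  rewrite exchange_big; apply: eq_bigr => u _ /=.
  rewrite (bigD1 (Mone eM, u)) //= eqxx scale1r big1 ?addr0 //.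
  by move=> p /negbTE ->; rewrite scale0r.
move=> p _; rewrite /rho sum_ffunE scaler_suml.
by apply: eq_bigr => u _; rewrite ffunE.
Qed.

(** On the fibre above [e], right translation by [v] permutes the terms of
    [rho]. *)
Lemma rho_mul_basis (k : fieldType) (X : finGroupType) (G : {group X})
    (M : {set X}) (eM : 1%g \in M) (fM : unique_factorization G M)
    (dM : left_division fM) (q : Mtype M * Gtype G) :
  \sum_u Amul_basis k dM (Mone eM, u) q = (q.1 == Mone eM)%:R *: rho k G eM.
Proof.
case: q => t v; rewrite [(t, v).1]/=; have [-> | /negbTE t_e] := eqVneq t (Mone eM).
  rewrite scale1r /rho [RHS](reindex_inj (mulIg v)).
  by apply: eq_bigr => u _; rewrite Amul_basis11.
by rewrite scale0r big1 // => u _; rewrite /Amul_basis ract1 t_e scale0r.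
Qed.

(** The mirror image of [rho_mul_basis]; here the Kronecker delta compares
    [s <| u] with [e], so that vanishing off the fibre above [e] is exactly
    [ract_eq1]. *)
Lemma basis_mul_rho (k : fieldType) (X : finGroupType) (G : {group X})
    (M : {set X}) (eM : 1%g \in M) (fM : unique_factorization G M)
    (dM : left_division fM) (p : Mtype M * Gtype G) :
  \sum_v Amul_basis k dM p (Mone eM, v) = (p.1 == Mone eM)%:R *: rho k G eM.
Proof.
case: p => s u; rewrite [(s, u).1]/=; have [-> | /negbTE s_e] := eqVneq s (Mone eM).
  rewrite scale1r /rho [RHS](reindex_inj (mulgI u)).
  by apply: eq_bigr => v _; rewrite Amul_basis11.
rewrite scale0r big1 // => v _.
by rewrite /Amul_basis eq_sym ract_eq1 s_e scale0r.
Qed.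

Theorem proposition2p7 (k : fieldType) (X : finGroupType) (G : {group X})
    (M : {set X}) (eM : 1%g \in M) (fM : unique_factorization G M)
    (dM : left_division fM) :
  integral_element eM dM (rho k G eM).
Proof.
split=> h; rewrite /Amul /counit scaler_suml.
  rewrite exchange_big; apply: eq_bigr => q _ /=.
  rewrite -scalerA -(rho_mul_basis k eM dM)
    -(rho_sum eM (fun p => Amul_basis k dM p q)) scaler_sumr.
  by apply: eq_bigr => p _; rewrite scalerA mulrC.
apply: eq_bigr => p _.
rewrite -scalerA -(basis_mul_rho k eM dM)
  -(rho_sum eM (Amul_basis k dM p)) scaler_sumr.
by apply: eq_bigr => q _; rewrite scalerA.
Qed.
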